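(* Let $\{f_i\}_{i\in[m]}$ be a frame for $\mathcal H^n$, and put $f_{m+1}=0$. Then $\{f_i-f_{i+1}\}_{i\in[m]}$ is also a frame for $\mathcal H^n$, and the two frames $\{f_i\}_{i\in[m]}$ and $\{f_i-f_{i+1}\}_{i\in[m]}$ are woven.
   Context: $[m]=\{1,2,\dots,m\}$, and $\mathcal H^n$ denotes an $n$-dimensional Hilbert space. A family $\{f_i\}_{i\in I}$ in a Hilbert space $\mathcal H$ is a frame for $\mathcal H$ if there are constants $A,B>0$ with $A\|f\|^2\le\sum_{i\in I}|\langle f,f_i\rangle|^2\le B\|f\|^2$ for all $f\in\mathcal H$. Two frames $\{f_i\}_{i\in I}$ and $\{g_i\}_{i\in I}$ for $\mathcal H$ are woven if for every $\sigma\subseteq I$ the family $\{f_i\}_{i\in\sigma}\cup\{g_i\}_{i\in\sigma^c}$ (with $\sigma^c=I\setminus\sigma$, counted with multiplicity) is a frame for $\mathcal H$. *)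

(* Defs.v *)
From HB Require Import structures.
From mathcomp Require Import all_boot all_order all_algebra.
From mathcomp Require Export sesquilinear.
From mathcomp Require Export reals.
From mathcomp.real_closed Require Export complex.

Set Implicit Arguments.
Unset Strict Implicit.
Unset Printing Implicit Defensive.

Import Order.TTheory GRing.Theory Num.Theory.
Local Open Scope ring_scope.

(* The scalars K are meant to be a realType R with theta = idfun, or R[i] with
   theta = conjC. The inner product is linear in its first argument, and
   [dot x x] is the squared norm of x. When K = R[i], the order of K is partial
   and 0 < A forces A to be a positive real. *)
Definition is_frame (K : numFieldType) (theta : K -> K) (V : vectType K)
    (dot : {dot V for theta}) (I : finType) (f : I -> V) : Prop :=
  exists A B : K, [/\ 0 < A, 0 < B &
    forall x : V,
      A * dot x x <= \sum_(i : I) `|dot x (f i)| ^+ 2 <= B * dot x x].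

(* The family {f_i}_{i in s} U {g_i}_{i notin s} is kept indexed by I, so that
   repeated vectors are counted with multiplicity. *)
Definition weave (I : finType) (V : Type) (s : {set I}) (f g : I -> V) :
  I -> V := fun i => if i \in s then f i else g i.

Definition woven (K : numFieldType) (theta : K -> K) (V : vectType K)
    (dot : {dot V for theta}) (I : finType) (f g : I -> V) : Prop :=
  [/\ is_frame dot f, is_frame dot g &
    forall s : {set I}, is_frame dot (weave s f g)].

(* Indices are shifted by one: f 0, ..., f (m - 1) stand for f_1, ..., f_m, and
   [extend0 f m = 0] is the convention f_{m+1} = 0. *)
Definition extend0 (m : nat) (V : nmodType) (f : 'I_m -> V) (k : nat) : V :=
  oapp f 0 (insub k).

Definition succ_diff (m : nat) (V : zmodType) (f : 'I_m -> V) (i : 'I_m) : V :=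
  f i - extend0 f i.+1.

(* Main.v *)
Require Import Defs.
From mathcomp Require Import all_boot all_order all_algebra.
From mathcomp Require Import sesquilinear reals.
From mathcomp.real_closed Require Import complex.

(** Let [w] be any weaving of [f] and [succ_diff f]. Each [w i] is either [f i]
    or [f i - f (i+1)], so [f i = w i] or [f i = w i + f (i+1)]; since the
    family is extended by [0], descending induction expresses every [f i] as a
    sum of vectors [w j] with [j >= i]. A vector whose coefficients against [w]
    are small thus has small coefficients against [f], and the lower bound of
    the frame [f] passes to [w].

    The argument is made quantitative rather than through spanning, which
    avoids compactness and treats the real and the complex case at once: if
    [A] and [B] are frame bounds of [f], then
    - [|<x, f i>| <= \sum_j |<x, w j>|] and the Cauchy-Schwarz inequality yield
      the lower bound [A / (m ^ 2 + 1)] ([norm_dot_extend0_le],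
      [sum_dot_le_weave]);
    - [|u - v| ^ 2 <= 2 |u| ^ 2 + 2 |v| ^ 2] yields the upper bound [4 B]
      ([sum_dot_weave_le]).
    The difference family itself is the weaving for the empty set. *)

Import Order.TTheory GRing.Theory Num.Theory.

Local Open Scope ring_scope.
Local Open Scope complex_scope.

(** Cauchy-Schwarz against the constant family [1]: expand the square and apply
    [2 a b <= a ^ 2 + b ^ 2] to each product. *)
Lemma sqr_sum_le {K : numFieldType} {I : finType} (a : I -> K) :
  (forall i, 0 <= a i) ->
  (\sum_i a i) ^+ 2 <= #|I|%:R * \sum_i a i ^+ 2.
Proof.
move=> a_ge0; rewrite expr2 big_distrlr /=.
have le_mean : \sum_i \sum_j a i * a j
    <= \sum_i \sum_j (a i ^+ 2 + a j ^+ 2) / 2.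
  apply: ler_sum => i _; apply: ler_sum => j _.
  by apply: (real_leif_mean_square _ _).1; apply: ger0_real.
apply: le_trans le_mean _.
have sum_row i : \sum_j (a i ^+ 2 + a j ^+ 2) / 2
    = (#|I|%:R * a i ^+ 2 + \sum_j a j ^+ 2) / 2.
  by rewrite -mulr_suml big_split /= sumr_const -[_ *+ #|_|]mulr_natl.
rewrite (eq_bigr _ (fun i _ => sum_row i)) -mulr_suml big_split /= -mulr_sumr.
rewrite sumr_const -[(\sum_j _) *+ _]mulr_natl.
by rewrite -mulr2n -[X in X / 2]mulr_natr mulfK ?pnatr_eq0.
Qed.

Lemma sqr_normB_le {K : numFieldType} (u v : K) :
  `|u - v| ^+ 2 <= 2 * `|u| ^+ 2 + 2 * `|v| ^+ 2.
Proof.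
have le_sqr : `|u - v| ^+ 2 <= (`|u| + `|v|) ^+ 2.
  by rewrite lerXn2r ?nnegrE ?addr_ge0 // ler_normB.
apply: le_trans le_sqr _; rewrite sqrrD addrAC.
have le_mean : `|u| * `|v| *+ 2 <= `|u| ^+ 2 + `|v| ^+ 2.
  exact: (real_leif_mean_square_scaled (normr_real u) (normr_real v)).1.
by rewrite -mulrDr mulr_natl [leRHS]mulr2n lerD2l.
Qed.

Lemma extend0_ord {m : nat} {V : nmodType} (f : 'I_m -> V) (i : 'I_m) :
  extend0 f i = f i.
Proof. by rewrite /extend0 valK. Qed.

Lemma extend0_out {m : nat} {V : nmodType} (f : 'I_m -> V) (k : nat) :
  (m <= k)%N -> extend0 f k = 0.
Proof. by move=> le_mk; rewrite /extend0 insubN // -leqNgt. Qed.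

Section WeaveWithSuccDiff.

Context {K : numFieldType} {theta : K -> K} {V : vectType K}.
Context (dot : {dot V for theta}) {m : nat} (f : 'I_m -> V) (s : {set 'I_m}).

Local Notation w := (weave s f (succ_diff f)).

(** Descending induction on [k], along [f k = w k] or [f k = w k + f (k+1)].
    Keeping only the indices [j >= k] on the right makes the induction close
    without accumulating a constant. *)
Lemma norm_dot_extend0_le (x : V) (k : nat) :
  `|dot x (extend0 f k)| <= \sum_(j < m | (k <= j)%N) `|dot x (w j)|.
Proof.
have [d] : exists d, (m <= k + d)%N by exists m; rewrite leq_addl.
elim: d k => [|d IHd] k; have [lt_km|le_mk] := ltnP k m.
- by rewrite addn0 leqNgt lt_km.
- by rewrite extend0_out // linear0r normr0 sumr_ge0.
- rewrite addnS -addSn => /IHd le_next.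
  rewrite (bigD1 (Ordinal lt_km)) //=.
  have -> : \sum_(j < m | (k <= j)%N && (j != Ordinal lt_km)) `|dot x (w j)|
      = \sum_(j < m | (k < j)%N) `|dot x (w j)|.
    by apply: eq_bigl => j; rewrite -val_eqE /= ltn_neqAle andbC eq_sym.
  rewrite (extend0_ord f (Ordinal lt_km)) /weave; case: ifP => _.
    by rewrite lerDl sumr_ge0.
  apply: le_trans (lerD (lexx _) le_next).
  by apply: le_trans (ler_normD _ _); rewrite -linearDr subrK.
- by rewrite extend0_out // linear0r normr0 sumr_ge0.
Qed.

Lemma sum_dot_le_weave (x : V) :
  \sum_i `|dot x (f i)| ^+ 2 <= (m ^ 2)%:R * \sum_i `|dot x (w i)| ^+ 2.
Proof.
have le_all i : `|dot x (f i)| ^+ 2 <= m%:R * \sum_j `|dot x (w j)| ^+ 2.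
  rewrite -[m in m%:R]card_ord; apply: le_trans (sqr_sum_le _ _) => //.
  rewrite lerXn2r ?nnegrE ?sumr_ge0 // -extend0_ord.
  apply: le_trans (norm_dot_extend0_le x i) _.
  by rewrite [leRHS](bigID (fun j : 'I_m => (i <= j)%N)) lerDl sumr_ge0.
apply: le_trans (ler_sum _ (fun i _ => le_all i)) _.
by rewrite sumr_const card_ord -[(_ * _) *+ _]mulr_natl mulrA -natrM.
Qed.

Lemma sum_dot_shift_le (x : V) :
  \sum_(i < m) `|dot x (extend0 f i.+1)| ^+ 2 <= \sum_i `|dot x (f i)| ^+ 2.
Proof.
under [leRHS]eq_bigr => i _ do rewrite -extend0_ord.
set F := fun k => `|dot x (extend0 f k)| ^+ 2.
(* Both sums are the sum of [F] over [0..m], without its first term on the left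
   and without its last one, which vanishes, on the right. *)
have Fm0 : F m = 0 by rewrite /F extend0_out // linear0r normr0 expr0n.
have <- : F 0 + \sum_(i < m) F i.+1 = \sum_(i < m) F i.
  transitivity (\sum_(k < m.+1) F k); first by rewrite big_ord_recl.
  by rewrite big_ord_recr /= Fm0 addr0.
by rewrite lerDr exprn_ge0.
Qed.

Lemma sum_dot_weave_le (x : V) :
  \sum_i `|dot x (w i)| ^+ 2 <= 4 * \sum_i `|dot x (f i)| ^+ 2.
Proof.
have le_term i : `|dot x (w i)| ^+ 2
    <= 2 * `|dot x (f i)| ^+ 2 + 2 * `|dot x (extend0 f i.+1)| ^+ 2.
  rewrite /weave; case: ifP => _; last by rewrite linearBr sqr_normB_le.
  by rewrite mulr_natl mulr2n -addrA lerDl addr_ge0 ?mulr_ge0 ?exprn_ge0.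
apply: le_trans (ler_sum _ (fun i _ => le_term i)) _.
rewrite big_split /= -!mulr_sumr -mulrDr (natrM K 2 2) -mulrA.
by rewrite ler_pM2l // mulr_natl mulr2n lerD2l sum_dot_shift_le.
Qed.

Lemma is_frame_weave_succ_diff : is_frame dot f -> is_frame dot w.
Proof.
move=> [A [B [A_gt0 B_gt0 bounds]]].
(* The extra 1 keeps the denominator positive for the empty family. *)
exists (A / (m ^ 2).+1%:R), (4 * B).
split=> [||x]; rewrite ?divr_gt0 ?mulr_gt0 ?ltr0n //.
have /andP[le_lower le_upper] := bounds x; apply/andP; split.
  rewrite mulrAC ler_pdivrMr ?ltr0n // [leRHS]mulrC.
  apply: le_trans le_lower (le_trans (sum_dot_le_weave x) _).
  rewrite ler_wpM2r ?ler_nat // sumr_ge0 // => i _; exact: exprn_ge0.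
by apply: le_trans (sum_dot_weave_le x) _; rewrite -mulrA ler_pM2l.
Qed.

End WeaveWithSuccDiff.

Lemma is_frame_eq {K : numFieldType} {theta : K -> K} {V : vectType K}
    (dot : {dot V for theta}) {I : finType} {f g : I -> V} :
  f =1 g -> is_frame dot f -> is_frame dot g.
Proof.
move=> eq_fg [A [B [A_gt0 B_gt0 bounds]]]; exists A, B; split=> // x.
by under eq_bigr => i _ do rewrite -eq_fg; exact: bounds.
Qed.

Lemma woven_succ_diff {K : numFieldType} {theta : K -> K} {V : vectType K}
    (dot : {dot V for theta}) {m : nat} (f : 'I_m -> V) :
  is_frame dot f ->
  is_frame dot (succ_diff f) /\ woven dot f (succ_diff f).
Proof.
move=> frame_f.
have frame_w s := is_frame_weave_succ_diff dot f s frame_f.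
have frame_diff : is_frame dot (succ_diff f).
  by apply: is_frame_eq (frame_w set0) => i; rewrite /weave inE.
by split.
Qed.

Theorem proposition3p1 (R : realType) (n m : nat) :
  (forall (V : vectType R) (dot : {dot V for idfun}) (f : 'I_m -> V),
     \dim {:V} = n -> is_frame dot f ->
     is_frame dot (succ_diff f) /\ woven dot f (succ_diff f)) /\
  (forall (V : vectType R[i]) (dot : {dot V for Num.conj}) (f : 'I_m -> V),
     \dim {:V} = n -> is_frame dot f ->
     is_frame dot (succ_diff f) /\ woven dot f (succ_diff f)).
Proof. by split=> V dot f _; apply: woven_succ_diff. Qed.
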